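(* For every composition $I$ (of some integer $n\ge 1$), \[ \mathrm{PT}^A_I(q)\;=\;e_I(q)\;=\;\sum_{J\succeq I}\left(-\tfrac{1}{q}\right)^{\ell(I)-\ell(J)}q^{-\mathrm{st}'(I,J)}\,\mathrm{QFact}_A(J), \] where the sum runs over all compositions $J$ of $n$ coarser than or equal to $I$.
   Context: Compositions: a composition of $n$ is a sequence $I=(i_1,\dots,i_r)$ of positive integers with sum $n$; $\ell(I)=r$; $\mathrm{Des}(I)=\{i_1,i_1+i_2,\dots,i_1+\dots+i_{r-1}\}$. $I$ is finer than $J$ (equivalently $J$ is coarser than $I$), written $I\preceq J$ or $J\succeq I$, if $\mathrm{Des}(I)\supseteq\mathrm{Des}(J)$. For $I\preceq J$ set $\mathrm{st}'(I,J)=\#\{(a,b)\in\mathrm{Des}(I)\times\mathrm{Des}(J): a\le b\}$ and $\mathrm{st}(I,J)=\#\{(a,b)\in\mathrm{Des}(I)\times\mathrm{Des}(J): a\ge b\}$. $[m]_q=1+q+\dots+q^{m-1}$, and $\mathrm{QFact}_A(j_1,\dots,j_p)=[p]_q^{j_1}[p-1]_q^{j_2}\cdots[2]_q^{j_{p-1}}[1]_q^{j_p}$. Permutation tableaux: let $k\ge1$ and let $\lambda=(\lambda_1\ge\dots\ge\lambda_k\ge0)$ be a Young diagram with exactly $k$ rows (rows of length $0$ allowed) and exactly $n-k$ (nonempty) columns, drawn in French convention (rows left-justified, longest row at the bottom). Encode $\lambda$ by the composition $I=(i_1,\dots,i_k)$ of $n$ where, for $1\le t\le k$, $i_t-1$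 is the number of columns of length $k-t+1$; this is a bijection between such diagrams and compositions of $n$ with $k$ parts. A (type A) permutation tableau of shape $\lambda$ is a filling of the boxes of $\lambda$ with $0$'s and $1$'s such that (1) every column contains at least one $1$, and (2) no box containing a $0$ has both a $1$ below it in the same column and a $1$ to its left in the same row. Its rank is (number of $1$'s) minus (number of columns). $\mathrm{PT}^A_I(q)=\sum_T q^{\mathrm{rank}(T)}$, over permutation tableaux $T$ of the shape encoded by $I$. Algebraic setting: work over $\mathbb{K}(q)$, $\mathbb K$ a field of characteristic $0$. A packed word is a finite word over positive integers whose set of letters is $\{1,\dots,m\}$ for some $m$; $\mathrm{pack}(w)$ replaces each occurrence of the $t$-th smallest letter of $w$ by $t$. For a packed word $w=w_1\cdots w_n$: $\mathrm{DC}(w)$ is the composition of $n$ with descent set $\{i:w_i>w_{i+1}\}$; $\mathrm{WC}(w)$ is the composition of $n$ whose descent set is the set of positions $p<n$ such that the letter $w_p$ does not occur in $w_{p+1}\cdots w_n$; $\mathrm{sinv}(w)$ is the number of pairs $i<j$ with $w_i>w_j$ and $w_j$ not occurring in $w_{j+1}\cdots w_n$. $\mathbf{WQSym}$ is the vector space with basis $(\mathbf M_u)$ indexed by packed words, with product $\mathbf M_{u'}\mathbf M_{u''}=\sum\mathbf M_u$ over packed words $u=v\cdot w$ (concatenation) with $\mathrm{pack}(v)=u'$, $\mathrm{pack}(w)=u''$. The (associative) product $\star_q$ is the bilinear product with $\mathbf M_{u'}\star_q\mathbf M_{u''}=\sum q^{\mathrm{sinv}(u)-\mathrm{sinv}(u')-\mathrm{sinv}(u'')}\mathbf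 M_u$ over the same $u$. Let $\mathbf{Sym}$ be the quotient of $\mathbf{WQSym}$ by the span of all $\mathbf M_u-\mathbf M_v$ with $\mathrm{WC}(u)=\mathrm{WC}(v)$, $\zeta$ the quotient map, and $\Psi_I=\zeta(\mathbf M_u)$ for any $u$ with $\mathrm{WC}(u)=I$; $(\Psi_I)$ is a basis (this realizes noncommutative symmetric functions with Tevlin's monomial basis). Let $\tilde S_m=\sum\mathbf M_u$ over nondecreasing packed words $u$ of length $m$, and $S^{J}(q)=\zeta(\tilde S_{j_1}\star_q\cdots\star_q\tilde S_{j_l})$ for $J=(j_1,\dots,j_l)$. Let $L_J(q)=\sum_{I\preceq J}q^{\mathrm{st}(I,J)}\Psi_I$ (a basis). $e_I(q)$ denotes the coefficient of $L_I(q)$ in the expansion of $S^{(1^n)}(q)$, $(1^n)=(1,\dots,1)$. *)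

(* Defs.v *)
From HB Require Import structures.
From mathcomp Require Import all_boot all_order all_algebra.
Set Implicit Arguments. Unset Strict Implicit. Unset Printing Implicit Defensive.
Import Order.TTheory GRing.Theory Num.Theory.

Definition is_comp (n : nat) (I : seq nat) : bool :=
  all (fun x => 0 < x) I && (sumn I == n).

Fixpoint comps_aux (fuel n : nat) : seq (seq nat) :=
  match fuel with
  | 0 => if n == 0 then [:: [::]] else [::]
  | fuel'.+1 =>
      if n == 0 then [:: [::]]
      else flatten [seq [seq k :: c | c <- comps_aux fuel' (n - k)] | k <- iota 1 n]
  end.
Definition comps (n : nat) : seq (seq nat) := comps_aux n n.

Definition Des (I : seq nat) : seq nat :=
  [seq sumn (take k I) | k <- iota 1 (size I).-1].

Definition finer (I J : seq nat) : bool := all (fun b => b \in Des I) (Des J).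

Definition stp (I J : seq nat) : nat :=
  \sum_(a <- Des I) count (fun b => a <= b) (Des J).
Definition st (I J : seq nat) : nat :=
  \sum_(a <- Des I) count (fun b => b <= a) (Des J).

(* composition of m with descent set D (D a strictly increasing list in [1,m-1]) *)
Definition comp_of_des (m : nat) (D : seq nat) : seq nat :=
  pairmap (fun a b => b - a) 0 (D ++ [:: m]).

Local Open Scope ring_scope.

Section Fq.
Variable K : fieldType.

Definition Fq : Type := {fraction {poly K}}.
Definition qv : Fq := FracField.tofrac ('X : {poly K}).

Definition qint (m : nat) : Fq := \sum_(i < m) qv ^+ i.

Definition QFactA (J : seq nat) : Fq :=
  \prod_(t < size J) qint (size J - t)%N ^+ nth 0%N J t.

(* column lengths, left to right (French convention): for t = 1..k,
   i_t - 1 columns of length k - t + 1 *)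
Definition colL (I : seq nat) : seq nat :=
  flatten [seq nseq (nth 0%N I t).-1 (size I - t)%N | t <- iota 0 (size I)].

(* boxes are pairs (c, r): column c (0 = leftmost), row r (0 = bottom);
   all indices are < n = sumn I *)
Definition inshape (I : seq nat) (c r : nat) : bool := (r < nth 0%N (colL I) c)%N.

Definition is_PT (I : seq nat) (f : {ffun 'I_(sumn I) * 'I_(sumn I) -> bool}) : bool :=
  [&& [forall c : 'I_(sumn I), forall r : 'I_(sumn I), ~~ inshape I c r ==> ~~ f (c, r)],
      [forall c : 'I_(sumn I), (c < size (colL I))%N ==> [exists r : 'I_(sumn I), f (c, r)]] &
      [forall c : 'I_(sumn I), forall r : 'I_(sumn I),
         (inshape I c r && ~~ f (c, r)) ==>
         ~~ ([exists r' : 'I_(sumn I), (r' < r)%N && f (c, r')] &&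
             [exists c' : 'I_(sumn I), (c' < c)%N && f (c', r)])]].

Definition PT_rank (I : seq nat) (f : {ffun 'I_(sumn I) * 'I_(sumn I) -> bool}) : nat :=
  (#|[pred x | f x]| - size (colL I))%N.

Definition PTA (I : seq nat) : Fq :=
  \sum_(f : {ffun 'I_(sumn I) * 'I_(sumn I) -> bool} | is_PT f) qv ^+ PT_rank f.

Definition packed (w : seq nat) : bool :=
  (0%N \notin w) && all (fun k => k \in w) (iota 1 (foldr maxn 0%N w)).

Definition pack (w : seq nat) : seq nat :=
  [seq (index x (sort leq (undup w))).+1 | x <- w].

Definition WC (w : seq nat) : seq nat :=
  comp_of_des (size w)
    [seq p <- iota 1 (size w).-1 | nth 0%N w p.-1 \notin drop p w].

Definition sinv (w : seq nat) : nat :=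
  \sum_(0 <= j < size w) \sum_(0 <= i < j)
     ((nth 0%N w j < nth 0%N w i) && (nth 0%N w j \notin drop j.+1 w))%N.

(* elements of WQSym: coefficient functions u |-> coefficient of M_u
   (finitely supported on packed words) *)
Definition WQ := seq nat -> Fq.

(* bilinear extension of  M_u' *_q M_u'' = sum_{u = v.w, pack v = u', pack w = u''}
   q^(sinv u - sinv u' - sinv u'') M_u *)
Definition starq (x y : WQ) : WQ := fun u =>
  if packed u then
    \sum_(0 <= a < (size u).+1)
      x (pack (take a u)) * y (pack (drop a u)) *
      qv ^ ((sinv u)%:Z - (sinv (pack (take a u)))%:Z - (sinv (pack (drop a u)))%:Z)
  else 0.

Definition WQunit : WQ := fun u => (u == [::])%:R.

Definition tildeS (m : nat) : WQ := fun u =>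
  (packed u && (size u == m) && sorted leq u)%:R.

Definition pwords (m : nat) : seq (seq nat) :=
  [seq w <- [seq [seq (f i).+1 | i <- enum 'I_m] | f : {ffun 'I_m -> 'I_m}] | packed w].

(* Sym, in coordinates of the basis (Psi_I): functions on compositions.
   zeta(M_u) = Psi_{WC(u)} *)
Definition Sym := seq nat -> Fq.
Definition zeta (m : nat) (x : WQ) : Sym := fun I =>
  \sum_(u <- pwords m | WC u == I) x u.

Definition SJ (m : nat) (J : seq nat) : Sym :=
  zeta m (foldr starq WQunit [seq tildeS j | j <- J]).

Definition LJ (J : seq nat) : Sym := fun I =>
  if finer I J then qv ^+ st I J else 0.

Definition L_expansion (n : nat) (e : seq nat -> Fq) : Prop :=
  forall I, is_comp n I ->
    SJ n (nseq n 1%N) I = \sum_(J <- comps n) e J * LJ J I.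

Definition ThmRHS (n : nat) (I : seq nat) : Fq :=
  \sum_(J <- comps n | finer I J)
     (- qv^-1) ^+ (size I - size J)%N * qv ^- stp I J * QFactA J.

End Fq.

(* Main.v *)
Require Import Defs.
From HB Require Import structures.
From mathcomp Require Import all_boot all_order all_algebra zify ring.
Import GRing.Theory.
Local Open Scope ring_scope.

(** Peeling off first letters, the [q^sinv]-sum over the packed words [u] with
    [WC u = I] is [QFactA I], so [e] is characterised by
    [QFactA I = \sum_(J coarser than I) q^(st I J) * e J].  This triangular system
    is inverted explicitly by induction on the first part of [I].

    It remains to see that [PTA] solves it.  Build a permutation tableau by adding
    columns from right to left, and let ['X] count the unrestricted rows (those with
    no zero above a one).  Adding a row is multiplication by ['X], and adding a
    column is the operator [E] with
    [(1 + (q - 1) 'X) * E p = 'X * (p(1 + q 'X) - p)], so that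
    [PTA (a :: I)] is the value at [1] of [E^(a-1) ('X * p_I)].  Merging two parts
    replaces the multiplication by ['X] at their boundary by [E], hence the sum
    over [J] is obtained from a word in the operators [E] and [q^m 'X + E].
    The polynomials [f_m = \prod_(j < m) ([j]_q + q^j 'X)] satisfy [E f_m = [m]_q f_m]
    and [(q^m 'X + E) f_m = f_(m+1)], which evaluates that word to [QFactA I]. *)

(** * Coarsenings of a composition *)

Lemma is_comp_behead n a I : is_comp n (a :: I) -> is_comp (n - a) I.
Proof. by rewrite /is_comp /= => /andP[/andP[_ ->]] /=; lia. Qed.

Definition add_head (a : nat) (J : seq nat) : seq nat :=
  if J is b :: J' then (a + b)%N :: J' else [:: a].

(** Each boundary between consecutive parts is kept ([cons]) or erased ([add_head]). Every later
    induction on the first part follows this recursion rather than the filter by [finer]. *)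
Fixpoint coarsenings (I : seq nat) : seq (seq nat) :=
  if I is a :: I' then
    if I' is [::] then [:: [:: a]]
    else map (cons a) (coarsenings I') ++ map (add_head a) (coarsenings I')
  else [:: [::]].

Arguments coarsenings : simpl never.

Lemma coarsenings1 a : coarsenings [:: a] = [:: [:: a]].
Proof. by []. Qed.

Lemma coarsenings_cons a b I :
  coarsenings [:: a, b & I] =
  map (cons a) (coarsenings (b :: I)) ++ map (add_head a) (coarsenings (b :: I)).
Proof. by []. Qed.

Lemma coarsenings_is_comp n I J :
  is_comp n I -> J \in coarsenings I -> is_comp n J.
Proof.
rewrite /is_comp; elim: I J n => [|a [|b I] IH] J n.
- by move=> H; rewrite inE => /eqP->.
- by move=> H; rewrite inE => /eqP->.
move=> H; have H' := is_comp_behead _ _ _ H.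
rewrite coarsenings_cons mem_cat => /orP[] /mapP[J' HJ' ->];
  have := IH _ _ H' HJ'; move: H; case: J' {HJ'} => [|c J'] /=; lia.
Qed.

Lemma coarsenings_neq0 a I J : J \in coarsenings (a :: I) -> J != [::].
Proof.
case: I => [|b I]; first by rewrite inE => /eqP->.
by rewrite coarsenings_cons mem_cat => /orP[] /mapP[[|c J'] _ ->].
Qed.

Lemma Des1 a : Des [:: a] = [::]. Proof. by []. Qed.

Lemma Des_cons a b I : Des [:: a, b & I] = a :: map (addn a) (Des (b :: I)).
Proof.
rewrite /Des /= addn0; congr cons.
by rewrite -map_comp (iotaDl 1 1) -map_comp; apply: eq_map => k /=.
Qed.

Lemma Des_add_head a J : J != [::] -> Des (add_head a J) = map (addn a) (Des J).
Proof.
case: J => [|b [|c J]] // _; rewrite /add_head ?Des1 // !Des_cons /=; congr cons.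
by rewrite -map_comp; apply: eq_map => k /=; rewrite addnA.
Qed.

Lemma size_Des I : size (Des I) = (size I).-1.
Proof. by rewrite size_map size_iota. Qed.

Lemma Des_gt0 I : all (fun x => 0 < x)%N I -> all (fun x => 0 < x)%N (Des I).
Proof.
elim: I => [|a [|b I] IH] // /andP[a_gt0 /IH _]; rewrite Des_cons /= a_gt0 /=.
by apply/allP=> _ /mapP[x _ ->]; rewrite addn_gt0 a_gt0.
Qed.

Lemma mem_addn_map a s x : ((a + x)%N \in map (addn a) s) = (x \in s).
Proof. by rewrite mem_map //; apply: addnI. Qed.

Lemma sum_map_addn a (s t : seq nat) (r : nat -> nat -> bool) :
  (forall x y, r (a + x)%N (a + y)%N = r x y) ->
  (\sum_(d <- map (addn a) s) count (r d) (map (addn a) t) =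
   \sum_(d <- s) count (r d) t)%N.
Proof.
move=> Hr; rewrite big_map; apply: eq_bigr => d _; rewrite count_map.
by apply: eq_count => y /=; rewrite Hr.
Qed.

(** The common least descent [a] lies weakly below all [(size I).+1] descents of the finer
    composition, while no other descent of [a :: J] lies weakly below [a]. *)
Lemma st_cons a b I J :
  J != [::] -> all (fun x => 0 < x)%N J ->
  st [:: a, b & I] (a :: J) = ((size I).+1 + st (b :: I) J)%N.
Proof.
case: J => // c J _ /Des_gt0 Jp; rewrite /st !Des_cons big_cons /= leqnn.
rewrite (@eq_in_count _ _ pred0) ?count_pred0; last first.
  by move=> _ /mapP[x /(allP Jp) x0 ->] /=; lia.
rewrite big_split /=.
rewrite (sum_map_addn _ _ _ (fun d e => e <= d)%N) => [|x y]; last by rewrite leq_add2l.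
rewrite addn0 addnA; congr (_ + _)%N.
rewrite big_map (eq_bigr (fun=> 1%N)) => [|x _]; last by rewrite leq_addr.
by rewrite sum1_size size_Des /= addnC addn1.
Qed.

Lemma st_add_head a b I J :
  J != [::] -> all (fun x => 0 < x)%N J ->
  st [:: a, b & I] (add_head a J) = st (b :: I) J.
Proof.
move=> J0 /Des_gt0 Jp; rewrite /st Des_add_head // Des_cons big_cons /=.
rewrite (@eq_in_count _ _ pred0) ?count_pred0; last first.
  by move=> _ /mapP[x /(allP Jp) x0 ->] /=; lia.
by rewrite (sum_map_addn _ _ _ (fun d e => e <= d)%N) => // x y; rewrite leq_add2l.
Qed.

(** Here the descent [a] of the finer composition is paired with all [size J] descents of
    [a :: J]. *)
Lemma stp_cons a b I J :
  all (fun x => 0 < x)%N (b :: I) -> J != [::] ->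
  stp [:: a, b & I] (a :: J) = (size J + stp (b :: I) J)%N.
Proof.
case: J => // c J /Des_gt0 Ip _; rewrite /stp !Des_cons big_cons /= leqnn.
rewrite (@eq_in_count _ _ predT) ?count_predT; last first.
  by move=> _ /mapP[x _ ->] /=; lia.
rewrite size_map size_Des big_split /=.
rewrite (sum_map_addn _ _ _ leq) => [|x y]; last by rewrite leq_add2l.
congr (_ + _)%N; rewrite big_map big1_seq ?add0n // => x /andP[_ /(allP Ip)].
by lia.
Qed.

Lemma stp_add_head a b I J :
  J != [::] -> stp [:: a, b & I] (add_head a J) = ((size J).-1 + stp (b :: I) J)%N.
Proof.
move=> J0; rewrite /stp Des_add_head // Des_cons big_cons /=.
rewrite (@eq_in_count _ _ predT) ?count_predT; last first.
  by move=> _ /mapP[x _ ->] /=; lia.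
rewrite size_map size_Des.
by rewrite (sum_map_addn _ _ _ leq) => // x y; rewrite leq_add2l.
Qed.

Lemma size_add_head a J : J != [::] -> size (add_head a J) = size J.
Proof. by case: J. Qed.

Lemma coarsenings_size I J : J \in coarsenings I -> (size J <= size I)%N.
Proof.
elim: I J => [|a [|b I] IH] J.
- by rewrite inE => /eqP->.
- by rewrite inE => /eqP->.
rewrite coarsenings_cons mem_cat => /orP[] /mapP[J' HJ' ->].
  by rewrite /= ltnS IH.
by rewrite size_add_head ?(coarsenings_neq0 _ _ _ HJ') // leqW ?IH.
Qed.

(** * Coarsenings inside the enumeration of all compositions *)

Lemma comps_auxS fuel n : comps_aux fuel.+1 n.+1 =
  [seq k :: c | k <- iota 1 n.+1, c <- comps_aux fuel (n.+1 - k)].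
Proof. by []. Qed.

Lemma comps_auxP fuel n J : (n <= fuel)%N -> (J \in comps_aux fuel n) = is_comp n J.
Proof.
elim: fuel n J => [|fuel IH] [|n] J // Hn.
- by case: J => [|[|a] J]; rewrite /is_comp //= andbF.
- by case: J => [|[|a] J]; rewrite /is_comp //= andbF.
rewrite comps_auxS; apply/allpairsPdep/idP => [[k [c []]]|].
  rewrite mem_iota => Hk; rewrite IH; last by lia.
  by rewrite /is_comp => Hc -> /=; lia.
case: J => [|k J] // HJ; exists k, J; rewrite mem_iota IH; last first.
  by move: HJ; rewrite /is_comp /=; lia.
by move: HJ; rewrite /is_comp /= => /andP[/andP[-> ->]]; split=> //; lia.
Qed.

Lemma mem_comps n J : (J \in comps n) = is_comp n J.
Proof. exact: comps_auxP. Qed.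

Lemma comps_aux_uniq fuel n : uniq (comps_aux fuel n).
Proof.
elim: fuel n => [|fuel IH] [|n] //; rewrite comps_auxS.
apply: allpairs_uniq_dep => [|k _|]; [exact: iota_uniq | exact: IH |].
by case=> [k c] [k' c'] /= _ _ [-> ->].
Qed.

Lemma comps_uniq n : uniq (comps n).
Proof. exact: comps_aux_uniq. Qed.

Lemma add_head_inj a J J' : all (fun x => 0 < x)%N J -> all (fun x => 0 < x)%N J' ->
  add_head a J = add_head a J' -> J = J'.
Proof.
case: J J' => [|b J] [|b' J'] //= H H' []; first by lia.
- by move: H; case: b => //= b _; lia.
by move=> /addnI -> ->.
Qed.

Lemma coarsenings_uniq n I : is_comp n I -> uniq (coarsenings I).
Proof.
elim: I n => [|a [|b I] IH] n // H.
have H' := is_comp_behead _ _ _ H.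
have pos J : J \in coarsenings (b :: I) -> all (fun x => 0 < x)%N J.
  by move=> /(coarsenings_is_comp _ _ _ H')/andP[].
rewrite coarsenings_cons cat_uniq !map_inj_in_uniq ?(IH _ H') //=; last first.
- by move=> x y _ _ [].
- by move=> x y /pos Hx /pos Hy; apply: add_head_inj.
(* The two kinds of coarsenings are disjoint, because a merged first part exceeds [a]. *)
rewrite andbT; apply/hasPn => _ /mapP[J HJ ->]; apply/negP => /mapP[J' HJ'].
have := coarsenings_neq0 _ _ _ HJ; have := pos _ HJ.
by case: J {HJ} => // c J /= /andP[c0 _] _ []; lia.
Qed.

Lemma mem_coarsenings n I J :
  is_comp n I -> (J \in coarsenings I) = is_comp n J && finer I J.
Proof.
move=> H; apply/idP/andP => [HJ|[]].
  split; first exact: coarsenings_is_comp HJ.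
  elim: I n H J HJ => [|a [|b I] IH] n H J.
  - by rewrite inE => /eqP->.
  - by rewrite inE => /eqP->.
  have H' := is_comp_behead _ _ _ H.
  rewrite coarsenings_cons mem_cat => /orP[] /mapP[J' HJ' ->];
    have J0 := coarsenings_neq0 _ _ _ HJ'; have /allP HF := IH _ H' _ HJ'.
  - case: J' J0 HF {HJ'} => // c J' _ HF; rewrite /finer !Des_cons /= mem_head /=.
    apply/allP=> _ /mapP[x /HF Hx ->]; by rewrite inE mem_addn_map Hx orbT.
  - rewrite /finer Des_add_head // Des_cons; apply/allP=> _ /mapP[x /HF Hx ->].
    by rewrite inE mem_addn_map Hx orbT.
elim: I n H J => [|a [|b I] IH] n H J HJ HF.
- move: H; rewrite /is_comp => /eqP Hn; rewrite inE; move: HJ; rewrite /is_comp -Hn.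
  by case: J {HF} => [|[|c] J] //=; rewrite andbF.
- rewrite inE; case: J HJ HF => [|c [|d J]]; last 1 first.
  + by move=> _; rewrite /finer Des_cons.
  + by move: H; rewrite /is_comp /=; lia.
  by move: H; rewrite /is_comp /= => H H' _; apply/eqP; congr [:: _]; lia.
have H' := is_comp_behead _ _ _ H.
have Ip : all (fun x => 0 < x)%N (Des (b :: I)) by apply: Des_gt0; case/andP: H'.
rewrite coarsenings_cons mem_cat.
case: J HJ HF => [|c J] HJ HF; first by move: HJ H; rewrite /is_comp /=; lia.
(* The first part [c] of [J] decides the kind: [a < c] means that the boundary at [a] is erased,
   [a = c] that it is kept. If [c < a], then [c] would be a descent of [J] below the least descent
   of [I], or, when [J] has one part, the sum would be too small. *)
have [ltac|ltca|eqac] := ltngtP a c.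
- apply/orP; right; apply/mapP; exists (c - a :: J)%N; last first.
    by rewrite /add_head subnKC // ltnW.
  apply: IH H' _ _ _.
    by move: HJ; rewrite /is_comp /= => /andP[/andP[_ ->]]; lia.
  move/allP: HF.
  have -> : c :: J = add_head a (c - a :: J)%N by rewrite /add_head subnKC // ltnW.
  rewrite Des_add_head // Des_cons => HF; apply/allP=> x Hx.
  have /HF : (a + x)%N \in map (addn a) (Des (c - a :: J)%N) by rewrite mem_addn_map.
  rewrite inE mem_addn_map => /orP[/eqP|//].
  have /allP/(_ _ Hx) : all (fun x => 0 < x)%N (Des (c - a :: J)%N).
    apply: Des_gt0; move: HJ; rewrite /is_comp /= => /andP[/andP[_ ->] _].
    by rewrite subn_gt0 ltac.
  by lia.
- exfalso; case: J HJ HF => [|d J] HJ.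
    by move: HJ H; rewrite /is_comp /=; lia.
  by rewrite /finer !Des_cons /= inE => /andP[/orP[/eqP E|/mapP[x _ E]] _]; lia.
- apply/orP; left; rewrite -eqac; apply/mapP; exists J => //.
  case: J HJ HF => [|d J] HJ HF.
    by move: HJ H; rewrite /is_comp /=; lia.
  apply: IH H' _ _ _.
    by move: HJ; rewrite /is_comp /= => /andP[/andP[_ ->]]; lia.
  move: HF; rewrite -eqac /finer !Des_cons /= => /andP[_ /allP HF]; apply/allP=> x Hx.
  have /HF : (a + x)%N \in map (addn a) (Des (d :: J)) by rewrite mem_addn_map.
  rewrite inE mem_addn_map => /orP[/eqP|//].
  have /allP/(_ _ Hx) : all (fun x => 0 < x)%N (Des (d :: J)).
    by apply: Des_gt0; move: HJ; rewrite /is_comp /= => /andP[/andP[_ ->]].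
  by lia.
Qed.

Lemma big_comps_finer (R : nmodType) n I (F : seq nat -> R) :
  is_comp n I ->
  \sum_(J <- comps n | finer I J) F J = \sum_(J <- coarsenings I) F J.
Proof.
move=> H; rewrite -big_filter; apply: perm_big; apply: uniq_perm.
- by rewrite filter_uniq // comps_uniq.
- exact: coarsenings_uniq H.
by move=> J; rewrite mem_filter mem_comps (mem_coarsenings _ _ _ H) andbC.
Qed.

(** * Inversion of the matrix [q ^ st] *)

Section Inversion.
Variables (F : fieldType) (q : F).
Hypothesis q_neq0 : q != 0.

Lemma st_stp_inversion n I (g : seq nat -> F) :
  is_comp n I ->
  \sum_(J <- coarsenings I)
    (- q^-1) ^+ (size I - size J)%N * q ^- stp I J *
    (\sum_(L <- coarsenings J) q ^+ st J L * g L) = g I.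
Proof.
elim: I n g => [|a [|b I] IH] n g.
- by rewrite !big_seq1 /stp /st /= !big_nil !expr0 invr1 !mul1r.
- rewrite coarsenings1 big_seq1 coarsenings1 big_seq1 /stp /st /= !big_nil subnn.
  by rewrite !expr0 invr1 !mul1r.
move=> H; have H' := is_comp_behead _ _ _ H.
rewrite coarsenings_cons big_cat /= !big_map -big_split /=.
(* The terms [add_head a L] cancel between the two kinds of coarsenings of [a :: b :: I]. *)
rewrite -[RHS](IH _ (fun L => g (a :: L)) H'); apply: eq_big_seq => J HJ.
have sJ := coarsenings_size _ _ HJ.
have J0 := coarsenings_neq0 _ _ _ HJ.
have HJc := coarsenings_is_comp _ _ _ H' HJ.
rewrite size_add_head // stp_add_head // stp_cons //; last by case/andP: H'.
(* The coarsenings of [add_head a J] are the [add_head a L] with [L] a coarsening of [J], and [st]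
   is unchanged. *)
have -> : \sum_(L <- coarsenings (add_head a J)) q ^+ st (add_head a J) L * g L =
          \sum_(L <- coarsenings J) q ^+ st J L * g (add_head a L).
  case: J HJ sJ J0 HJc => // c [|d J] HJ sJ J0 HJc; first by rewrite !big_seq1.
  rewrite /add_head -/(add_head a _) !coarsenings_cons !big_cat !big_map /=.
  have HJ' := is_comp_behead _ _ _ HJc.
  congr (_ + _); apply: eq_big_seq => L HL;
    have L0 := coarsenings_neq0 _ _ _ HL;
    have /andP[Lp _] := coarsenings_is_comp _ _ _ HJ' HL.
    by rewrite !st_cons.
  rewrite !st_add_head // ; congr (_ * g _); case: L L0 {HL Lp} => // e L _ /=.
  by rewrite addnA.
case: J HJ sJ J0 HJc => // c J HJ sJ _ HJc.
rewrite coarsenings_cons big_cat /= !big_map.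
have eL : \sum_(L <- coarsenings (c :: J)) q ^+ st [:: a, c & J] (a :: L) * g (a :: L) =
    q ^+ (size J).+1 * \sum_(L <- coarsenings (c :: J)) q ^+ st (c :: J) L * g (a :: L).
  rewrite big_distrr /=; apply: eq_big_seq => L HL.
  rewrite st_cons ?(coarsenings_neq0 _ _ _ HL) //; first by rewrite exprD mulrA.
  by case/andP: (coarsenings_is_comp _ _ _ HJc HL).
have eM : \sum_(L <- coarsenings (c :: J)) q ^+ st [:: a, c & J] (add_head a L) * g (add_head a L) =
   \sum_(L <- coarsenings (c :: J)) q ^+ st (c :: J) L * g (add_head a L).
  apply: eq_big_seq => L HL.
  rewrite st_add_head ?(coarsenings_neq0 _ _ _ HL) //.
  by case/andP: (coarsenings_is_comp _ _ _ HJc HL).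
rewrite {}eL {}eM !subSS; set A := \sum_(_ <- _) _; set B := \sum_(_ <- _) _.
rewrite subSn // exprS !addSn !exprS !exprD.
have qS : q ^+ size J != 0 by rewrite expf_neq0.
set T := stp _ _.
have qT : q ^+ T != 0 by rewrite expf_neq0.
by field; rewrite ?qS ?qT.
Qed.
End Inversion.

(** * The column operator and its eigenvectors *)

Section ColumnOperator.
Variables (F : fieldType) (q : F).

Local Notation qn m := (\sum_(i < m) q ^+ i).

(* Sum over the fillings of a new leftmost column with [s] unrestricted rows,
   of [q ^ (ones - 1) * 'X ^ (rows left unrestricted)]. *)
Fixpoint col_monomial (s : nat) : {poly F} :=
  if s is s'.+1 then 'X ^+ s + (1 + q *: 'X) * col_monomial s' else 0.

(** The operator [E]: the linear extension of ['X^s] mapped to [col_monomial s]. *)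
Definition col_op (p : {poly F}) : {poly F} := \sum_(i < size p) p`_i *: col_monomial i.

Lemma col_opE (p : {poly F}) N : (size p <= N)%N -> col_op p = \sum_(i < N) p`_i *: col_monomial i.
Proof.
move=> H; rewrite /col_op (big_ord_widen _ (fun i => p`_i *: col_monomial i) H).
rewrite [RHS](bigID (fun i : 'I_N => (i < size p)%N)) /= [X in _ + X]big1 ?addr0 //.
by move=> i; rewrite -leqNgt => Hi; rewrite nth_default ?scale0r.
Qed.

Lemma col_op_is_linear : linear col_op.
Proof.
move=> a p r; set N := maxn (size (a *: p + r)) (maxn (size p) (size r)).
rewrite !(@col_opE _ N) ?leq_max ?leqnn ?orbT // scaler_sumr -big_split /=.
by apply: eq_bigr => i _; rewrite coefD coefZ scalerDl scalerA.
Qed.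
HB.instance Definition _ :=
  GRing.isLinear.Build F {poly F} {poly F} *:%R col_op col_op_is_linear.

Lemma col_opXn s : col_op 'X^s = col_monomial s.
Proof.
rewrite /col_op size_polyXn big_ord_recr /= big1 ?add0r.
  by rewrite coefXn eqxx scale1r.
by move=> i _; rewrite coefXn ltn_eqF ?scale0r.
Qed.

Lemma col_monomialE s :
  (1 + q *: 'X - 'X) * col_monomial s = 'X * ((1 + q *: 'X) ^+ s - 'X ^+ s).
Proof.
elim: s => [|s IH]; first by rewrite /= !expr0 subrr !mulr0.
rewrite /= mulrDr mulrCA IH !exprS; ring.
Qed.

Lemma col_op_divided_difference p :
  (1 + q *: 'X - 'X) * col_op p = 'X * (p \Po (1 + q *: 'X) - p).
Proof.
have Hp : p = \sum_(i < size p) p`_i *: 'X^i by rewrite -poly_def coefK.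
rewrite /col_op big_distrr /= comp_polyE [X in _ = _ * (_ - X)]Hp -sumrB big_distrr /=.
apply: eq_bigr => i _.
by rewrite -scalerAr col_monomialE -scalerBr -scalerAr.
Qed.

(** The polynomial [f_m]; its factor at [j = 0] is ['X], since the empty sum [[0]_q] vanishes. *)
Definition col_eigen (m : nat) : {poly F} := \prod_(j < m) (qn j *: 1 + q ^+ j *: 'X).

(** Substituting [1 + q 'X] for ['X] turns the factor of index [j] into that of index [j + 1]. So
    the divided difference only compares the last new factor with the lost factor ['X], and [[m+1]_q
    + q^(m+1) 'X - 'X = [m+1]_q (1 + (q - 1) 'X)]. *)
Lemma col_op_eigen m : col_op (col_eigen m.+1) = qn m.+1 *: col_eigen m.+1.
Proof.
have nz : (1 + q *: 'X - 'X : {poly F}) != 0.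
  apply/eqP=> /(congr1 (fun p : {poly F} => p.[0])); rewrite !hornerE.
  by rewrite ?mulr0 ?addr0 ?oppr0 ?addr0 => /eqP; rewrite oner_eq0.
apply: (mulfI nz); rewrite col_op_divided_difference.
pose g := \prod_(j < m) (qn j.+1 *: 1 + q ^+ j.+1 *: 'X) : {poly F}.
have e1 : col_eigen m.+1 = 'X * g.
  by rewrite /col_eigen big_ord_recl big_ord0 scale0r add0r expr0 scale1r.
have e2 : col_eigen m.+1 \Po (1 + q *: 'X) = g * (qn m.+1 *: 1 + q ^+ m.+1 *: 'X).
  rewrite /g -[RHS](big_ord_recr m (fun j => qn j.+1 *: 1 + q ^+ j.+1 *: 'X)).
  rewrite /col_eigen rmorph_prod /=; apply: eq_bigr => j _.
  rewrite comp_polyD !comp_polyZ comp_polyX comp_polyC.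
  rewrite scalerDr addrA -scalerDl scalerA -exprSr.
  by rewrite [in RHS]big_ord_recr.
rewrite e2 e1 -!mul_polyC.
have : (q - 1)%:P * (qn m.+1)%:P = (q ^+ m.+1)%:P - 1 :> {poly F}.
  by rewrite -polyCM -subrX1 polyCB.
rewrite polyCB polyC1; move: (qn _)%:P (q ^+ _)%:P q%:P => N Q r E.
have -> : Q = (r - 1) * N + 1 by rewrite E subrK.
by ring.
Qed.

Lemma col_op_eigenS m :
  q ^+ m.+1 *: ('X * col_eigen m.+1) + col_op (col_eigen m.+1) = col_eigen m.+2.
Proof.
rewrite col_op_eigen [RHS]big_ord_recr -/(col_eigen m.+1) /=.
by rewrite mulrDr -!scalerAr mulr1 addrC [_ * 'X]mulrC.
Qed.

Fixpoint tab_poly (I : seq nat) : {poly F} :=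
  if I is a :: I' then iter a.-1 col_op ('X * tab_poly I') else 1.

Lemma tab_poly_add_head a J : J != [::] -> all (fun x => 0 < x)%N (a :: J) ->
  tab_poly (add_head a J) = iter a.-1 col_op (col_op (tab_poly J)).
Proof.
case: J => // b J _ /and3P[a0 b0 _] /=.
by rewrite -iterSr -iterD; congr iter; lia.
Qed.

Lemma iter_col_opD m p r :
  iter m col_op (p + r) = iter m col_op p + iter m col_op r.
Proof. by elim: m => //= m ->; rewrite linearD. Qed.

Lemma iter_col_opZ m c p : iter m col_op (c *: p) = c *: iter m col_op p.
Proof. by elim: m => //= m ->; rewrite linearZ. Qed.

Lemma iter_col_op_sum m (s : seq (seq nat)) (f : seq nat -> {poly F}) :
  iter m col_op (\sum_(J <- s) f J) = \sum_(J <- s) iter m col_op (f J).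
Proof. by elim: m => //= m ->; rewrite linear_sum. Qed.

Lemma iter_col_op_eigen m k :
  iter m col_op (col_eigen k.+1) = qn k.+1 ^+ m *: col_eigen k.+1.
Proof.
by elim: m => /= [|m ->]; rewrite ?scale1r // linearZ /= col_op_eigen scalerA exprSr.
Qed.

(** Keeping the first boundary contributes [q ^ (size I).+1 'X], erasing it contributes [col_op].
    Their sum raises the index of [col_eigen] by one, and the remaining [a.-1] columns multiply by
    the eigenvalue. *)
Lemma sum_tab_poly n I : I != [::] -> is_comp n I ->
  \sum_(J <- coarsenings I) q ^+ st I J *: tab_poly J =
  (\prod_(t < size I) qn (size I - t)%N ^+ (nth 0%N I t).-1) *: col_eigen (size I).
Proof.
elim: I n => [|a [|b I] IH] n // _ H.
  rewrite coarsenings1 big_seq1 /st /= big_nil scale1r big_ord1 /= mulr1.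
  have -> : 'X = col_eigen 1.
    by rewrite /col_eigen big_ord1 big_ord0 scale0r add0r scale1r.
  by rewrite iter_col_op_eigen.
have H' := is_comp_behead _ _ _ H.
have a_gt0 : (0 < a)%N by case/andP: H => /andP[].
rewrite coarsenings_cons big_cat /= !big_map -big_split /=.
transitivity (iter a.-1 col_op
   (q ^+ (size I).+1 *: ('X * \sum_(J <- coarsenings (b :: I)) q ^+ st (b :: I) J *: tab_poly J)
   + col_op (\sum_(J <- coarsenings (b :: I)) q ^+ st (b :: I) J *: tab_poly J))).
  rewrite linear_sum big_distrr scaler_sumr -big_split iter_col_op_sum /=.
  apply: eq_big_seq => J HJ.
  have J0 := coarsenings_neq0 _ _ _ HJ.
  have /andP[Jp _] := coarsenings_is_comp _ _ _ H' HJ.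
  rewrite st_cons // st_add_head // tab_poly_add_head //=; last by rewrite a_gt0.
  by rewrite iter_col_opD -scalerAr scalerA -exprD linearZ /= !iter_col_opZ.
rewrite (IH _ _ H') // [X in _ = X *: _]big_ord_recl /= subn0; set c := \prod_(_ < _) _.
rewrite -scalerAr [col_op (c *: _)]linearZ /= scalerA [_ * c]mulrC -scalerA -scalerDr.
by rewrite col_op_eigenS iter_col_opZ iter_col_op_eigen scalerA [c * _]mulrC.
Qed.

Lemma sum_tab_poly_horner1 n I : I != [::] -> is_comp n I ->
  \sum_(J <- coarsenings I) q ^+ st I J * (tab_poly J).[1] =
  \prod_(t < size I) qn (size I - t)%N ^+ nth 0%N I t.
Proof.
move=> I0 H; have /(congr1 (horner^~ 1)) := sum_tab_poly n I I0 H.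
rewrite /= horner_sum hornerZ => E.
rewrite (eq_bigr (fun J => (q ^+ st I J *: tab_poly J).[1])) => [|J _]; last first.
  by rewrite hornerZ.
(* At [1] the factor of index [j] becomes [[j]_q + q^j = [j+1]_q]. Reversing the product aligns
   these factors with the parts, where each raises the exponent by the missing one. *)
rewrite {}E horner_prod [X in _ * X](reindex_inj rev_ord_inj) -big_split /=.
apply: eq_big_seq => t _; rewrite !hornerE.
have t_lt := ltn_ord t; have It : (0 < nth 0%N I t)%N.
  by case/andP: H => /allP H _; apply: H; apply: mem_nth.
rewrite -{2}(prednK It) exprSr; congr (_ * _).
by rewrite -(subnSK t_lt) [RHS]big_ord_recr.
Qed.

End ColumnOperator.

(** * Permutation tableaux *)

(** A nonempty subset of [r |: S] is [[set r]], or a nonempty subset of [S] with or without [r];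
    this matches the recursion of [col_monomial]. *)
Lemma big_subsets_setU1 (T : finType) (R : nmodType) (r : T) (S : {set T})
    (G : {set T} -> R) : r \notin S ->
  \sum_(c : {set T} | (c \subset r |: S) && (c != set0)) G c =
  G [set r] + \sum_(c : {set T} | (c \subset S) && (c != set0)) (G (r |: c) + G c).
Proof.
move=> rS; rewrite (bigID (fun c : {set T} => r \in c)) /= big_split addrA /=.
congr (_ + _); last first.
  apply: eq_bigl => c; case: (boolP (r \in c)) => rc; rewrite ?andbT ?andbF.
    by apply/esym/negbTE; apply: contra rS => /andP[/subsetP/(_ r rc)].
  by rewrite -[in RHS](setU1K rS) subsetD1 rc andbT.
rewrite [LHS](reindex_onto (fun c => r |: c) (fun c => c :\ r)) /=; last first.
  by move=> c /andP[_ rc]; rewrite setD1K.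
rewrite (bigD1 set0) /=; last first.
  by rewrite setU0 set11 subsetUl /= -card_gt0 cards1 /= setDv eqxx.
rewrite setU0; congr (_ + _); apply: eq_bigl => c.
have -> : (r |: c != set0) by apply/set0Pn; exists r; rewrite setU11.
rewrite setU11 !andbT; congr (_ && _); case: (boolP (r \in c)) => rc.
  rewrite (introF eqP) ?andbF => [|E]; last by rewrite -E setD11 in rc.
  by apply/esym/negbTE; apply: contra rS => /subsetP/(_ r rc).
by rewrite setU1K // eqxx andbT subUset subsetUl -[in RHS](setU1K rS) subsetD1 rc andbT.
Qed.

Lemma big_tuple_cons (T : finType) (R : nmodType) n (P : pred (seq T)) (G : seq T -> R) :
  \sum_(t : n.+1.-tuple T | P t) G t =
  \sum_(t : n.-tuple T) \sum_(c : T | P (c :: t)) G (c :: t).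
Proof.
rewrite pair_big_dep /= (reindex (fun p : n.-tuple T * T => cons_tuple p.2 p.1)) //=.
exists (fun t => (behead_tuple t, thead t)) => [[t c]|t] _ /=.
  by congr pair; apply: val_inj.
by rewrite [RHS]tuple_eta.
Qed.

Section Columns.
Variables (F : fieldType) (q : F) (N : nat).
Implicit Types (c S : {set 'I_N}) (cs : seq {set 'I_N}) (l : seq nat).

Definition rows m : {set 'I_N} := [set r : 'I_N | (r < m)%N].

(** Row [0] is the bottom one. By condition (2), such a row carries no one to the left of the column
    [c], provided its box in [c] lies in the shape. *)
Definition zeros_over_one c : {set 'I_N} :=
  [set r : 'I_N | (r \notin c) && [exists r' : 'I_N, (r' < r)%N && (r' \in c)]].

(* Columns are listed from left to right; a row is restricted by [cs] when a
   column to its left must have a zero there. *)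
Fixpoint restricted l cs : {set 'I_N} :=
  match l, cs with
  | m :: l', c :: cs' => (rows m :&: zeros_over_one c) :|: restricted l' cs'
  | _, _ => set0
  end.

(** The inclusion encodes both the shape and condition (2), and [c != set0] is condition (1). *)
Fixpoint valid_cols l cs : bool :=
  match l, cs with
  | [::], [::] => true
  | m :: l', c :: cs' =>
      [&& c \subset rows m :\: restricted l' cs', c != set0 & valid_cols l' cs']
  | _, _ => false
  end.

Definition cols_rank cs : nat := (\sum_(c <- cs) #|c|.-1)%N.

Definition cols_poly M l : {poly F} :=
  \sum_(t : (size l).-tuple {set 'I_N} | valid_cols l t)
    q ^+ cols_rank t *: 'X^#|rows M :\: restricted l t|.

(** A one in a row above all of [S] stays unrestricted and puts no new one below a row of [S]. *)
Lemma card_unrestricted_setU1 S c (r : 'I_N) :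
  (forall x, x \in S -> x < r)%N -> c \subset S -> c != set0 ->
  #|(r |: S) :\: zeros_over_one (r |: c)| = #|S :\: zeros_over_one c|.+1.
Proof.
move=> Sr cS c0; have rS : r \notin S by apply/negP=> /Sr; rewrite ltnn.
have -> : (r |: S) :\: zeros_over_one (r |: c) = r |: (S :\: zeros_over_one c).
  apply/setP=> x; rewrite !inE; have [->|xr] := eqVneq x r; first by [].
  rewrite /=; case: (boolP (x \in S)) => xS; rewrite ?andbF ?andbT //.
  congr (~~ (_ && _)); apply: eq_existsb => y; rewrite !inE.
  by have [->|//] := eqVneq y r; have := Sr _ xS; lia.
by rewrite cardsU1 !inE (negbTE rS) andbF.
Qed.

Lemma unrestricted_setU1_notin S c (r : 'I_N) :
  (forall x, x \in S -> x < r)%N -> c \subset S -> c != set0 ->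
  (r |: S) :\: zeros_over_one c = S :\: zeros_over_one c.
Proof.
move=> Sr /subsetP cS /set0Pn[y yc]; apply/setP=> x; rewrite !inE.
have [->|//] := eqVneq x r; have rS : r \notin S by apply/negP=> /Sr; rewrite ltnn.
rewrite (negbTE rS) andbF /= andbT; apply/negbTE; rewrite negbK.
rewrite (contra (@cS r)) //=; apply/existsP; exists y.
by rewrite yc andbT Sr ?cS.
Qed.

Lemma sum_columns S :
  \sum_(c : {set 'I_N} | (c \subset S) && (c != set0))
    q ^+ #|c|.-1 *: 'X^#|S :\: zeros_over_one c| = col_monomial F q #|S|.
Proof.
have [s cS] : exists s, #|S| = s by exists #|S|.
rewrite cS; elim: s S cS => [|s IH] S cS.
  move/eqP: cS; rewrite cards_eq0 => /eqP->; rewrite big_pred0 // => c.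
  by rewrite subset0; case: eqP.
have /set0Pn[r0 r0S] : S != set0 by rewrite -card_gt0 cS.
case: (@arg_maxnP _ r0 (mem S) (@nat_of_ord N)) => //= r rS rmax.
have Sr x : x \in S :\ r -> (x < r)%N.
  rewrite !inE => /andP[xr /rmax]; rewrite leq_eqVlt => /orP[/eqP E|//].
  by case/eqP: xr; apply: val_inj.
have cS' : #|S :\ r| = s by have := cardsD1 r S; rewrite rS cS => -[].
(* The topmost row [r] of [S]: either the column is [set r], or, below [r], it is
   a nonempty column, and then [r] is a one or becomes restricted. *)
rewrite -(setD1K rS) big_subsets_setU1 ?setD11 //.
rewrite cards1 /= scale1r; congr (_ + _).
  congr ('X^ _); rewrite -cS (setD1K rS); congr #|pred_of_set _|; apply/setP=> x.
  rewrite !inE; case: (boolP (x \in S)) => xS; rewrite ?andbF ?andbT //.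
  rewrite negb_and negbK; apply/orP; right; apply/existsPn => y.
  rewrite inE; apply/negP => /andP[yx /eqP yr]; have := rmax _ xS.
  by rewrite leqNgt -yr yx.
rewrite -(IH _ cS') big_distrr; apply: eq_bigr => c /andP[cS1 c0] /=.
rewrite card_unrestricted_setU1 // unrestricted_setU1_notin //.
have rc : r \notin c by apply/negP=> /(subsetP cS1); rewrite setD11.
rewrite cardsU1 rc.
have : (0 < #|c|)%N by rewrite card_gt0.
case: #|c| => // m _ /=; rewrite !exprS mulrDl mul1r addrC; congr (_ + _).
by rewrite -!scalerAl -!scalerAr scalerA.
Qed.

Lemma restricted_sub m l cs : all (fun x => x <= m)%N l -> restricted l cs \subset rows m.
Proof.
elim: l cs => [|m' l IH] [|c cs] /=; rewrite ?sub0set // => /andP[mm' /IH Hl].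
rewrite subUset Hl andbT; apply/subsetP=> x; rewrite !inE => /andP[xm _].
exact: leq_trans xm mm'.
Qed.

(** For fixed remaining columns [t], [sum_columns] is applied to the set of rows left unrestricted
    by [t], which is where the new column of full height may have its ones. *)
Lemma cols_poly_cons m l : all (fun x => x <= m)%N l ->
  cols_poly m (m :: l) = col_op F q (cols_poly m l).
Proof.
move=> lm; rewrite /cols_poly linear_sum [RHS]big_mkcond /=.
rewrite (big_tuple_cons _ _ _ (valid_cols (m :: l))
  (fun cs => q ^+ cols_rank cs *: 'X^#|rows m :\: restricted (m :: l) cs|)).
apply: eq_bigr => t _; case: (boolP (valid_cols l t)) => vt; last first.
  by rewrite big_pred0 // => c; rewrite /= (negbTE vt) !andbF.
rewrite linearZ /= col_opXn -sum_columns scaler_sumr; apply: eq_big => c.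
  by rewrite /= vt andbT.
move=> _; rewrite /cols_rank big_cons addnC exprD scalerA; congr (_ *: 'X^ _).
congr #|pred_of_set _|; apply/setP=> x; rewrite !inE.
by case: (x < m)%N; case: (x \in restricted l t); rewrite ?andbT ?andbF ?orbF ?orbT.
Qed.

(** The added row meets none of the columns, so it is always unrestricted. *)
Lemma cols_polyS m l : (m < N)%N -> all (fun x => x <= m)%N l ->
  cols_poly m.+1 l = 'X * cols_poly m l.
Proof.
move=> mN lm; rewrite /cols_poly big_distrr; apply: eq_bigr => t _ /=.
rewrite -scalerAr -exprS; congr (_ *: 'X^ _).
rewrite (_ : rows m.+1 :\: _ = Ordinal mN |: (rows m :\: restricted l t)).
  by rewrite cardsU1 !inE ltnn andbF.
apply/setP=> x; rewrite !inE ltnS leq_eqVlt -val_eqE /=.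
case: (eqVneq (x : nat) m) => //= xm; rewrite andbT.
by apply/negP=> /(subsetP (restricted_sub m _ _ lm)); rewrite inE xm ltnn.
Qed.

Lemma colL_cons a I : colL (a :: I) = nseq a.-1 (size I).+1 ++ colL I.
Proof.
by rewrite /colL /= subn0 (iotaDl 1 0) -map_comp; congr (_ ++ flatten _).
Qed.

Lemma colL_le I : all (fun x => x <= size I)%N (colL I).
Proof.
elim: I => [|a I IH] //; rewrite colL_cons all_cat /= all_nseq leqnn orbT /=.
by apply: sub_all IH => x /leqW.
Qed.

(** Passing from [I] to [a :: I] adds one row on top and then [a.-1] columns of full height on the
    left, as in the recursion of [tab_poly]. *)
Lemma cols_poly_colL I : (size I <= N)%N -> cols_poly (size I) (colL I) = tab_poly F q I.
Proof.
elim: I => [|a I IH] sN.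
  rewrite /cols_poly (big_pred1 [tuple]) => [|t]; last by rewrite [t]tuple0 /= eqxx.
  by rewrite /cols_rank big_nil scale1r setD0 (_ : rows 0 = set0) ?cards0.
rewrite [tab_poly _ _ _]/= -IH; last exact: ltnW.
rewrite colL_cons /= -cols_polyS ?colL_le //.
have le_all j : all (fun x => x <= (size I).+1)%N (nseq j (size I).+1 ++ colL I).
  rewrite all_cat all_nseq leqnn orbT; apply: sub_all (colL_le I) => x; exact: leqW.
by elim: a.-1 => //= j <-; rewrite cols_poly_cons.
Qed.

Lemma mem_restricted l cs (r : 'I_N) : size cs = size l ->
  reflect (exists d : nat, [/\ (d < size l)%N, (r < nth 0%N l d)%N
      & r \in zeros_over_one (nth set0 cs d)])
    (r \in restricted l cs).
Proof.
elim: l cs => [|m l IH] [|c cs] //=; first by move=> _; rewrite inE; right; case=> ? [].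
move=> [/IH IH']; rewrite !inE; apply: (iffP orP).
  case=> [/andP[rm rc]|/IH'[d [dl rd rz]]]; [by exists 0%N; split=> //; rewrite inE | by exists d.+1].
case=> -[|d] /= [dl rd rz]; first by left; rewrite rd /=; move: rz; rewrite inE.
by right; apply/IH'; exists d.
Qed.

(** This unfolds the recursion over columns into a condition on pairs [c < d], the form used by
    [is_PT]. *)
Lemma valid_colsP l cs : size cs = size l ->
  reflect [/\ forall (c : nat) (r : 'I_N), r \in nth set0 cs c -> (r < nth 0%N l c)%N,
    forall c : nat, (c < size l)%N -> nth set0 cs c != set0 &
    forall (c d : nat) (r : 'I_N), (c < d)%N -> r \in nth set0 cs c -> (r < nth 0%N l d)%N ->
       r \notin zeros_over_one (nth set0 cs d)]
   (valid_cols l cs).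
Proof.
elim: l cs => [|m l IH] [|c0 cs] //=.
  move=> _; constructor; split=> //; first by move=> c r; rewrite nth_nil inE.
  by move=> c d r _; rewrite nth_nil inE.
move=> [es]; have IH' := IH _ es; apply: (iffP and3P).
  case=> /subsetP s0 c00 /IH'[v1 v2 v3]; split.
  - by case=> [|c] r //= => [/s0|/v1//]; rewrite !inE => /andP[].
  - by case=> [|c] //=; apply: v2.
  case=> [|c] [|d] r //= cd; last exact: v3.
  move=> /s0; rewrite !inE => /andP[/(mem_restricted _ _ _ es) nr rm] rd.
  apply/negP=> rz; apply: nr; exists d; split=> //; last by rewrite inE.
  by rewrite ltnNge; apply/negP=> ld; rewrite nth_default in rd.
case=> v1 v2 v3; split; last 1 first.
- apply/IH'; split=> [c|c|c d]; [exact: (v1 c.+1) | exact: (v2 c.+1) | exact: (v3 c.+1 d.+1)].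
- apply/subsetP=> r r0; rewrite !inE (v1 0%N r) // andbT.
  by apply/(mem_restricted _ _ _ es) => -[d [dl rd]]; apply/negP; exact: (v3 0%N d.+1).
- exact: (v2 0%N).
Qed.

End Columns.

(** * Fillings of the shape as sequences of columns *)

Section Tableaux.
Variables (K : fieldType) (I : seq nat).
Hypothesis I_pos : all (fun x => 0 < x)%N I.
Local Notation N := (sumn I).
Local Notation p := (size (colL I)).

Lemma size_le_sumn : (size I <= N)%N.
Proof. by elim: I I_pos => //= a J IH /andP[a0 /IH]; lia. Qed.

Lemma size_colL_le_sumn : (p <= N)%N.
Proof.
elim: I I_pos => //= a J IH /andP[a0 /IH]; rewrite colL_cons size_cat size_nseq.
by lia.
Qed.

Definition fill_of_cols (cs : seq {set 'I_N}) : {ffun 'I_N * 'I_N -> bool} :=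
  [ffun x : 'I_N * 'I_N => x.2 \in nth set0 cs x.1].

Definition cols_of_fill (f : {ffun 'I_N * 'I_N -> bool}) : p.-tuple {set 'I_N} :=
  [tuple [set r | f (widen_ord size_colL_le_sumn c, r)] | c < p].

Lemma cols_of_fillK f : is_PT f -> fill_of_cols (cols_of_fill f) = f.
Proof.
case/and3P=> /forallP f1 _ _; apply/ffunP=> -[c r]; rewrite ffunE /=.
have [cp|pc] := ltnP c p.
  rewrite -(tnth_nth set0 (cols_of_fill f) (Ordinal cp)) tnth_mktuple inE.
  by congr (f (_, _)); apply: val_inj.
(* Beyond the last column both sides vanish: [nth] returns [set0], and the default column length [0]
   puts the box outside the shape. *)
rewrite (nth_default _ (_ : size (cols_of_fill f) <= c)%N) ?size_tuple // in_set0.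
apply/esym/negbTE.
move/forallP: (f1 c) => /(_ r)/implyP; apply.
by rewrite /inshape nth_default.
Qed.

Lemma fill_of_colsK (t : p.-tuple {set 'I_N}) : cols_of_fill (fill_of_cols t) = t.
Proof.
apply: eq_from_tnth => c; rewrite tnth_mktuple; apply/setP=> r.
by rewrite inE ffunE /= -tnth_nth.
Qed.

Lemma is_PT_fill_of_cols (t : p.-tuple {set 'I_N}) :
  is_PT (fill_of_cols t) = valid_cols N (colL I) t.
Proof.
have inN c (r : 'I_N) : r \in nth set0 t c -> (c < p)%N.
  by rewrite ltnNge; apply: contraL => pc; rewrite nth_default ?size_tuple // inE.
have pN := size_colL_le_sumn.
apply/and3P/valid_colsP; rewrite ?size_tuple //.
  case=> /forallP f1 /forallP f2 /forallP f3; split.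
  - move=> c r rc; have cN := leq_trans (inN _ _ rc) pN.
    have /forallP/(_ r)/implyP := f1 (Ordinal cN); rewrite ffunE /= rc.
    by move=> /contraLR; apply.
  - move=> c cp; have /implyP/(_ cp)/existsP[r] := f2 (Ordinal (leq_trans cp pN)).
    by rewrite ffunE /= => rc; apply/set0Pn; exists r.
  move=> c d r cd rc rd; have dp : (d < p)%N.
    by rewrite ltnNge; apply/negP=> ld; rewrite nth_default in rd.
  have dN := leq_trans dp pN; have cN := ltn_trans cd dN.
  rewrite inE; apply/negP=> /andP[rnd /existsP[r' /andP[r'r r'd]]].
  have /forallP/(_ r)/implyP := f3 (Ordinal dN); rewrite !ffunE /= rnd /inshape rd => /(_ isT).
  case/negP; apply/andP; split; apply/existsP; first by exists r'; rewrite ffunE r'r.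
  by exists (Ordinal cN); rewrite ffunE cd.
case=> v1 v2 v3; split.
- apply/forallP=> c; apply/forallP=> r; apply/implyP; rewrite ffunE.
  by apply: contra => /v1.
- apply/forallP=> c; apply/implyP=> cp; have /set0Pn[r rc] := v2 _ cp.
  by apply/existsP; exists r; rewrite ffunE.
apply/forallP=> c; apply/forallP=> r; apply/implyP; rewrite ffunE /= => /andP[rs rc].
apply/negP=> /andP[/existsP[r' /andP[r'r]]]; rewrite ffunE /= => r'c.
case/existsP=> c' /andP[c'c]; rewrite ffunE /= => rc'.
case/negP: (v3 _ _ _ c'c rc' rs); rewrite inE rc; apply/existsP; exists r'.
by rewrite r'r.
Qed.

Lemma PT_rank_fill_of_cols (t : p.-tuple {set 'I_N}) :
  valid_cols N (colL I) t -> PT_rank (fill_of_cols t) = cols_rank N t.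
Proof.
move=> /valid_colsP; rewrite size_tuple => /(_ erefl)[_ v2 _].
have -> : PT_rank (fill_of_cols t) = (\sum_(c <- t) #|c| - p)%N.
  rewrite /PT_rank; congr (_ - _)%N; rewrite -sum1_card.
  transitivity (\sum_(c < N) \sum_(r < N | fill_of_cols t (c, r)) 1)%N.
    by rewrite pair_big_dep; apply: eq_bigl => -[c r]; rewrite !inE.
  rewrite (big_nth set0) big_mkord size_tuple.
  rewrite (big_ord_widen N (fun c => #|nth set0 t c|) size_colL_le_sumn).
  rewrite [RHS]big_mkcond /=; apply: eq_bigr => c _.
  rewrite sum1_card; case: ltnP => cp; last first.
    by apply: eq_card0 => r; rewrite !inE -topredE /= ffunE nth_default ?size_tuple // inE.
  by apply: eq_card => r; rewrite -topredE /= ffunE.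
(* Columns are nonempty, so neither [#|c|.-1] nor the subtraction of [p] is truncated. *)
rewrite /cols_rank (eq_big_seq (fun c : {set 'I_N} => #|c|.-1 + 1)%N) => [|c ct].
  by rewrite big_split /= sum1_size size_tuple addnK.
rewrite addn1 prednK // card_gt0 -(nth_index set0 ct) v2 //.
by rewrite -[X in (_ < X)%N](size_tuple t) index_mem.
Qed.

(** Evaluation at [1] forgets the number of unrestricted rows and keeps only the rank. *)
Lemma PTA_tab_poly : PTA K I = (tab_poly _ (qv K) I).[1].
Proof.
rewrite -(cols_poly_colL _ _ N) ?size_le_sumn // /cols_poly horner_sum.
rewrite /PTA (reindex_onto (fun t : p.-tuple {set 'I_N} => fill_of_cols t) cols_of_fill cols_of_fillK) /=.
apply: eq_big => [t|t /andP[]]; rewrite is_PT_fill_of_cols.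
  by rewrite fill_of_colsK eqxx andbT.
move=> vt _; rewrite hornerZ hornerXn expr1n mulr1.
by rewrite PT_rank_fill_of_cols.
Qed.

End Tableaux.

(** * Packed words *)

Lemma foldr_maxn_ge w x : x \in w -> (x <= foldr maxn 0 w)%N.
Proof. by elim: w => //= y w IH; rewrite inE => /orP[/eqP->|/IH]; lia. Qed.

Lemma foldr_maxn_mem w : w != [::] -> foldr maxn 0%N w \in w.
Proof.
elim: w => //= x [|y w] IH _; first by rewrite maxn0 mem_head.
rewrite inE; case: (leqP (foldr maxn 0 (y :: w)) x)%N => H; first by rewrite eqxx.
by rewrite IH // orbT.
Qed.

Lemma eqi_iota_size w m : w =i iota 1 m -> size (undup w) = m.
Proof.
move=> H; rewrite -[RHS](size_iota 1); apply: perm_size.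
apply: uniq_perm; rewrite ?undup_uniq ?iota_uniq // => x.
by rewrite mem_undup H.
Qed.

Lemma packedP w : reflect (w =i iota 1 (size (undup w))) (packed w).
Proof.
apply: (iffP idP) => [/andP[w0 /allP wM]|H].
  have H : w =i iota 1 (foldr maxn 0%N w).
    move=> x; apply/idP/idP => [xw|/wM//]; rewrite mem_iota add1n ltnS.
    rewrite foldr_maxn_ge // andbT lt0n; apply/eqP=> x0.
    by rewrite -x0 xw in w0.
  by rewrite (eqi_iota_size _ _ H).
rewrite /packed H mem_iota /=; apply/allP=> k; rewrite H !mem_iota !add1n !ltnS.
move=> /andP[-> kM] /=; apply: leq_trans kM _.
have [->//|w0] := eqVneq w [::].
by have := foldr_maxn_mem _ w0; rewrite H mem_iota add1n ltnS => /andP[].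
Qed.

Lemma packed_eqi w m : w =i iota 1 m -> packed w.
Proof. by move=> H; apply/packedP; rewrite (eqi_iota_size _ _ H). Qed.

Lemma size_pack w : size (pack w) = size w.
Proof. by rewrite size_map. Qed.

Lemma packed_pack w : packed (pack w).
Proof.
apply: (@packed_eqi _ (size (undup w))) => k; rewrite mem_iota.
set s := sort leq (undup w).
have ss : size s = size (undup w) by rewrite size_sort.
have mem_s x : (x \in s) = (x \in w) by rewrite mem_sort mem_undup.
apply/mapP/idP => [[x xw ->]|/andP[k0 ks]].
  by rewrite add1n !ltnS -/s -ss index_mem mem_s.
exists (nth 0%N s k.-1); first by rewrite -mem_s mem_nth // ss; lia.
rewrite -/s index_uniq ?sort_uniq ?undup_uniq ?ss; lia.
Qed.

(* The first letter of a packed word either occurs again or is a new letter [x],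
   whose insertion shifts up the letters that are at least [x]. *)
Fixpoint packed_words (n : nat) : seq (seq nat) :=
  if n is n'.+1 then
    [seq x :: v | v <- packed_words n', x <- iota 1 (size (undup v))] ++
    [seq x :: map (bump x) v | v <- packed_words n', x <- iota 1 (size (undup v)).+1]
  else [:: [::]].

Arguments packed_words : simpl never.

Lemma packed_wordsS n : packed_words n.+1 =
  [seq x :: v | v <- packed_words n, x <- iota 1 (size (undup v))] ++
  [seq x :: map (bump x) v | v <- packed_words n, x <- iota 1 (size (undup v)).+1].
Proof. by []. Qed.

Lemma mem_packed_words n u : (u \in packed_words n) = packed u && (size u == n).
Proof.
elim: n u => [|n IH] u; first by case: u => [|x u] //=; rewrite andbF.
rewrite packed_wordsS mem_cat; apply/orP/andP => [[]|].
- move=> /allpairsPdep[v [x [+ xm ->]]]; rewrite IH => /andP[/packedP pv /eqP <-].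
  split=> //=; apply: (@packed_eqi _ (size (undup v))) => k; rewrite inE pv.
  by have [->|] := eqVneq k x; rewrite ?xm.
- move=> /allpairsPdep[v [x [+ xm ->]]]; rewrite IH => /andP[/packedP pv /eqP <-].
  split; last by rewrite /= size_map.
  apply: (@packed_eqi _ (size (undup v)).+1) => k; rewrite inE.
  apply/orP/idP => [[/eqP->//|/mapP[y]]|].
    by rewrite pv !mem_iota => ym ->; move: xm; rewrite mem_iota /bump; lia.
  rewrite mem_iota => km; have [->|kx] := eqVneq k x; first by left.
  right; apply/mapP; exists (unbump x k); last by rewrite unbumpK.
  by rewrite pv; move: xm; rewrite !mem_iota /unbump; move: kx; lia.
case: u => [|x w] [] // /packedP; set m := size _ => pu sw.
have xm : x \in iota 1 m by rewrite -pu mem_head.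
case: (boolP (x \in w)) => xw.
  left; apply/allpairsPdep; exists w, x.
  have ew : w =i iota 1 m.
    by move=> k; rewrite -pu inE; have [->|] := eqVneq k x; rewrite ?xw.
  by rewrite IH (packed_eqi _ _ ew) (eqi_iota_size _ _ ew).
right; apply/allpairsPdep; exists (map (unbump x) w), x.
have E : map (bump x) (map (unbump x) w) = w.
  rewrite -map_comp -[RHS]map_id; apply/eq_in_map => y yw /=; rewrite unbumpK //.
  by rewrite inE; apply: contraNneq xw => <-.
have m0 : (0 < m)%N by move: xm; rewrite mem_iota; lia.
have ew : map (unbump x) w =i iota 1 m.-1.
  move=> k; rewrite -(mem_map (can_inj (bumpK x))) E.
  have := pu (bump x k); rewrite inE (negbTE (_ : bump x k != x)) => /= [->|].
    by move: xm; rewrite !mem_iota /bump; lia.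
  by rewrite eq_sym neq_bump.
by rewrite E IH (packed_eqi _ _ ew) (eqi_iota_size _ _ ew) size_map prednK.
Qed.

Lemma packed_words_uniq n : uniq (packed_words n).
Proof.
elim: n => // n IH; rewrite packed_wordsS cat_uniq; apply/and3P; split.
- apply: allpairs_uniq_dep => // [v _|[v x] [v' x'] _ _ /= [-> ->]//].
  exact: iota_uniq.
(* The two lists are disjoint: the first letter occurs again in the first list only, as [bump x]
   never takes the value [x]. *)
- apply/hasPn=> _ /allpairsPdep[v [x [_ _ ->]]]; apply/negP.
  move=> /allpairsPdep[v' [x' [+ + [ex ev]]]]; rewrite mem_packed_words => /andP[/packedP pv _].
  by rewrite -ex -pv -ev => /mapP[y _ /eqP]; rewrite (negbTE (neq_bump _ _)).
apply: allpairs_uniq_dep => // [v _|[v x] [v' x'] _ _ /= [-> /inj_map->]//].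
  exact: iota_uniq.
exact: (can_inj (bumpK x')).
Qed.

Lemma perm_pwords n : perm_eq (pwords n) (packed_words n).
Proof.
apply: uniq_perm; rewrite ?packed_words_uniq //.
  rewrite filter_uniq // map_inj_uniq ?enum_uniq // => f g /= E; apply/ffunP=> i.
  have /(congr1 (fun s => nth 0%N s i)) /= := E.
  by rewrite !(nth_map i 0%N) ?size_enum_ord // !nth_ord_enum => -[] /val_inj.
move=> u; rewrite mem_packed_words mem_filter; apply: andb_id2l => pu.
apply/idP/idP => [/imageP[f _ ->]|/eqP su].
  by rewrite size_map size_enum_ord.
have le_n x : x \in u -> (0 < x <= n)%N.
  move/packedP: pu => ->; rewrite mem_iota add1n ltnS => /andP[->] /=.
  by move=> H; rewrite -su; apply: leq_trans H (size_undup _).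
apply/imageP; exists [ffun i : 'I_n => insubd i (nth 0%N u i).-1] => //.
apply: (@eq_from_nth _ 0%N); first by rewrite size_map size_enum_ord.
rewrite su => i lt_in.
rewrite (nth_map (Ordinal lt_in)) ?size_enum_ord // (nth_ord_enum _ (Ordinal lt_in)).
have := le_n _ (mem_nth 0%N (_ : i < size u)%N); rewrite su => /(_ lt_in) H.
by rewrite ffunE val_insubd /=; move: H; case: (nth 0%N u i) => // y /= ->.
Qed.

(** * [WC] and [sinv] of a word with a letter put in front *)

Lemma pairmap_subS a s :
  pairmap (fun a b => b - a)%N a.+1 (map S s) = pairmap (fun a b => b - a)%N a s.
Proof. by elim: s a => //= b s IH a; rewrite subSS IH. Qed.

(** Position [1] is a descent exactly when [x] does not occur again, and the descents of the tail
    shift by one. *)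
Lemma WC_cons x y w :
  WC [:: x, y & w] =
  if x \in y :: w then add_head 1 (WC (y :: w)) else 1%N :: WC (y :: w).
Proof.
rewrite /WC /comp_of_des; set D := [seq p <- iota 1 (size (y :: w)).-1 | _].
have -> : [seq p <- iota 1 (size [:: x, y & w]).-1 |
      nth 0%N [:: x, y & w] p.-1 \notin drop p [:: x, y & w]] =
    (if x \in y :: w then [::] else [:: 1%N]) ++ map S D.
  rewrite [size _]/= [_.-1]/= [iota _ _]/= [filter _ _]/= (iotaDl 1 1) filter_map.
  have -> : [seq p <- iota 1 (size w) | preim (addn 1) (fun p =>
      nth 0%N [:: x, y & w] p.-1 \notin drop p [:: x, y & w]) p] = D.
    by apply: eq_in_filter => -[|p]; rewrite mem_iota.
  by case: (x \in y :: w).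
case: ifP => _ /=; rewrite -[[:: (size w).+2]]/(map S [:: size (y :: w)]) -map_cat.
  by case: D => [|a D] /=; rewrite ?pairmap_subS !subn0 add1n.
congr cons; exact: (pairmap_subS 0).
Qed.

Lemma WC1 x : WC [:: x] = [:: 1%N].
Proof. by []. Qed.

Lemma WC_neq0 x w : WC (x :: w) != [::].
Proof. by case: w => // y w; rewrite WC_cons; case: ifP => // _; case: (WC _). Qed.

Lemma WC_gt0 x w : all (fun x => 0 < x)%N (WC (x :: w)).
Proof.
elim: w x => [|y w IH] x //; rewrite WC_cons; case: ifP => _; last by rewrite /= IH.
by case: (WC _) (IH y) => //= a J /andP[_ ->].
Qed.

(** The parts end at the last occurrences of letters, one for each distinct letter. *)
Lemma size_WC x w : size (WC (x :: w)) = size (undup (x :: w)).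
Proof.
elim: w x => [|y w IH] x //; rewrite WC_cons.
have -> : undup [:: x, y & w] = if x \in y :: w then undup (y :: w) else x :: undup (y :: w).
  by [].
by case: ifP => _; rewrite ?size_add_head ?WC_neq0 // [LHS]/= IH.
Qed.

Lemma WC_map f w : injective f -> WC (map f w) = WC w.
Proof.
move=> f_inj; case: w => // x w; elim: w x => [|y w IH] x //.
by rewrite /= !WC_cons -[f y :: map f w]/(map f (y :: w)) mem_map // IH.
Qed.

Lemma WC_mem x v : x \in v -> WC (x :: v) = add_head 1 (WC v).
Proof. by case: v => // y w xv; rewrite WC_cons xv. Qed.

Lemma WC_bump x v : v != [::] -> WC (x :: map (bump x) v) = 1%N :: WC v.
Proof.
have bump_inj := can_inj (bumpK x); case: v => // y w _.
rewrite -(WC_map (bump x) (y :: w)) // /= WC_cons ifF //.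
apply/negbTE/negP=> /(@mapP _ _ (bump x) (y :: w))[z _ /eqP].
by rewrite (negbTE (neq_bump x z)).
Qed.

(** Only last occurrences count on the right of a pair, so [x] gains one inversion for each distinct
    smaller letter. *)
Lemma sinv_cons x w : sinv (x :: w) = (count (fun y => y < x) (undup w) + sinv w)%N.
Proof.
rewrite /sinv big_nat_recl //= big_geq // add0n.
under eq_bigr => j _ do rewrite big_nat_recl //=.
rewrite big_split /=; congr (_ + _)%N; elim: w => [|y w IH]; first by rewrite big_nil.
rewrite big_nat_recl //= drop0 IH; case: ifP => _; first by rewrite andbF.
by rewrite andbT.
Qed.

Lemma sinv_map f w : {mono f : x y / (x < y)%N} -> injective f -> sinv (map f w) = sinv w.
Proof.
move=> f_mono f_inj; elim: w => // x w IH; rewrite /= !sinv_cons IH undup_map_inj //.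
by rewrite count_map; congr (_ + _)%N; apply: eq_count => y /=; rewrite f_mono.
Qed.

Lemma ltn_bump x : {mono bump x : y z / (y < z)%N}.
Proof. by move=> y z; rewrite /bump; lia. Qed.

Lemma count_lt_packed x w : packed w -> x \in iota 1 (size (undup w)).+1 ->
  count (fun y => y < x)%N (undup w) = x.-1.
Proof.
move=> /packedP pw; rewrite mem_iota; set m := size (undup w) => xm.
have /permP-> : perm_eq (undup w) (iota 1 m).
  by apply: uniq_perm; rewrite ?undup_uniq ?iota_uniq // => k; rewrite mem_undup.
have -> : m = (x.-1 + (m - x.-1))%N by lia.
rewrite iotaD count_cat (@eq_in_count _ _ predT) ?count_predT ?size_iota; last first.
  by move=> k; rewrite mem_iota /=; lia.
rewrite (@eq_in_count _ _ pred0) ?count_pred0 ?addn0 // => k; rewrite mem_iota /=.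
by lia.
Qed.

Section Words.
Variable K : fieldType.
Local Notation q := (qv K).

Lemma sum_iota_qv m : \sum_(x <- iota 1 m) q ^+ x.-1 = qint K m.
Proof.
by rewrite /qint -(big_mkord xpredT (fun i => q ^+ i)) (iotaDl 1 0) big_map /index_iota subn0.
Qed.

Lemma QFactA_cons a I : QFactA K (a :: I) = qint K (size I).+1 ^+ a * QFactA K I.
Proof. by rewrite /QFactA big_ord_recl /= subn0. Qed.

(** A first letter [x] adds [x.-1] to [sinv]. Whether it is old or new, it ranges over
    [1, ..., size I], because [size I] is the number of distinct letters of the whole word; so
    removing it gives the factor [[size I]_q]. *)
Lemma sum_packed_words n I : is_comp n.+1 I ->
  \sum_(u <- packed_words n.+1 | WC u == I) q ^+ sinv u = QFactA K I.
Proof.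
elim: n I => [|n IH] I HI.
  have -> : I = [:: 1%N].
    by case: I HI => [|[|[|a]] [|[|b] I]] //; rewrite /is_comp /=; lia.
  rewrite (_ : packed_words 1 = [:: [:: 1%N]]) // big_cons WC1 eqxx big_nil.
  rewrite QFactA_cons /QFactA big_ord0 /qint big_ord1 sinv_cons /sinv big_geq //.
  by rewrite !expr0 expr1 addr0 mulr1.
have word_spec v : v \in packed_words n.+1 ->
    [/\ v != [::], packed v & size (WC v) = size (undup v)].
  rewrite mem_packed_words => /andP[pv]; case: v pv => // y w pv _.
  by split=> //; apply: size_WC.
have step_old : \sum_(v <- packed_words n.+1) \sum_(x <- iota 1 (size (undup v)))
      (if WC (x :: v) == I then q ^+ sinv (x :: v) else 0) =
    \sum_(v <- packed_words n.+1 | add_head 1 (WC v) == I)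
      qint K (size I) * q ^+ sinv v.
  rewrite [RHS]big_mkcond; apply: eq_big_seq => v /word_spec[v0 pv sv].
  rewrite -(sum_iota_qv (size I)); case: eqP => [E|NE]; last first.
    rewrite big1_seq // => x /andP[_]; move/packedP: (pv) => <- xv.
    by rewrite WC_mem //; case: eqP.
  rewrite -E size_add_head ?sv; last by case: (v) v0 => // *; apply: WC_neq0.
  rewrite big_distrl; apply: eq_big_seq => x xv /=; rewrite sinv_cons count_lt_packed //.
    by rewrite WC_mem ?eqxx ?exprD //; move/packedP: (pv) => ->.
  by move: xv; rewrite !mem_iota; lia.
have step_new : \sum_(v <- packed_words n.+1) \sum_(x <- iota 1 (size (undup v)).+1)
      (if WC (x :: map (bump x) v) == I then q ^+ sinv (x :: map (bump x) v) else 0) =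
    \sum_(v <- packed_words n.+1 | 1%N :: WC v == I) qint K (size I) * q ^+ sinv v.
  rewrite [RHS]big_mkcond; apply: eq_big_seq => v /word_spec[v0 pv sv].
  rewrite -(sum_iota_qv (size I)); case: eqP => [E|NE]; last first.
    by rewrite big1_seq // => x _; rewrite WC_bump //; case: eqP.
  rewrite -E [size (_ :: _)]/= sv big_distrl; apply: eq_big_seq => x xv /=.
  rewrite WC_bump // E eqxx sinv_cons undup_map_inj; last exact: can_inj (bumpK x).
  rewrite sinv_map; [|exact: ltn_bump|exact: can_inj (bumpK x)].
  rewrite count_map -(count_lt_packed _ _ pv xv) -exprD; congr (_ ^+ (_ + _)).
  by apply: eq_count => y /=; rewrite /bump; lia.
rewrite big_mkcond packed_wordsS big_cat !big_allpairs_dep /= step_old step_new.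
(* Only one sum survives: a first part [1] comes from a new letter, a larger one from a letter that
   occurs again. *)
rewrite -!big_distrr /=; case: I HI {step_old step_new} => [|[|[|a]] I] HI //.
- rewrite big1_seq ?mulr0 ?add0r => [|v /andP[/eqP E /word_spec[]]]; last first.
    case: v E => // y w; have := WC_gt0 y w; have := WC_neq0 y w.
    by case: (WC _) => //= b J _ /andP[b0 _] []; lia.
  rewrite (eq_bigl (fun v => WC v == I)) => [|v]; last by rewrite eqseq_cons.
  by rewrite IH ?QFactA_cons ?expr1.
rewrite [X in _ + _ * X]big1 => [|v /eqP[]//]; rewrite mulr0 addr0.
rewrite big_seq_cond (eq_bigl (fun v => (v \in packed_words n.+1) && (WC v == a.+1 :: I))).
  have HI' : is_comp n.+1 (a.+1 :: I) by move: HI; rewrite /is_comp /=; lia.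
  by rewrite -big_seq_cond (IH _ HI') !QFactA_cons mulrA -exprS.
move=> v /=; apply: andb_id2l => /word_spec[]; case: v => // y w _ _ _.
by case: (WC _) (WC_neq0 y w) => //= b J _; rewrite !eqseq_cons add1n eqSS.
Qed.

End Words.

(** * The expansion coefficients and their two evaluations *)

Lemma qv_neq0 (K : fieldType) : qv K != 0.
Proof. by rewrite /qv tofrac_eq0 polyX_eq0. Qed.

(** In each product only the cut after the first letter contributes, with exponent
    [sinv u - sinv (pack v)] for [u = x :: v], and these exponents telescope. *)
Lemma foldr_starq_tildeS1 (K : fieldType) n u : packed u -> size u = n ->
  foldr (@starq K) (@WQunit K) [seq tildeS K j | j <- nseq n 1%N] u = qv K ^+ sinv u.
Proof.
elim: n u => [|n IH] u pu su; first by rewrite (size0nil su) /= /sinv big_nil.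
case: u pu su => // x v pu [sv]; rewrite [LHS]/= /starq pu [size _]/= !big_nat_recl //.
rewrite {1}/tildeS size_pack /= !mul0r add0r take0 drop0.
rewrite [X in _ + X]big_nat big1 ?addr0 => [|a /andP[_ av]]; last first.
  rewrite /tildeS size_pack /= size_take_min.
  rewrite (_ : (_ == 1%N) = false) ?andbF ?mul0r //; lia.
have -> : pack [:: x] = [:: 1%N] by rewrite /pack /= eqxx.
have -> : sinv [:: 1%N] = 0%N by rewrite sinv_cons /= /sinv big_nil.
rewrite mul1r IH ?packed_pack ?size_pack // subr0 exprnP -expfzDr ?qv_neq0 //.
by rewrite addrC subrK.
Qed.

Lemma SJ_ones (K : fieldType) n I : is_comp n.+1 I ->
  SJ K n.+1 (nseq n.+1 1%N) I = QFactA K I.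
Proof.
move=> HI; rewrite -(sum_packed_words K n I HI) /SJ /zeta (perm_big _ (perm_pwords _)).
rewrite big_seq_cond [RHS]big_seq_cond; apply: eq_bigr => u /andP[].
by rewrite mem_packed_words => /andP[pu /eqP su] _; apply: foldr_starq_tildeS1.
Qed.

Lemma sum_LJ (K : fieldType) n I (e : seq nat -> Fq K) : is_comp n I ->
  \sum_(J <- comps n) e J * LJ K J I = \sum_(J <- coarsenings I) qv K ^+ st I J * e J.
Proof.
move=> HI; rewrite -(big_comps_finer _ _ _ (fun J => qv K ^+ st I J * e J) HI).
rewrite [RHS]big_mkcond; apply: eq_bigr => J _; rewrite /LJ.
by case: ifP => _; rewrite ?mulr0 // mulrC.
Qed.

(** The expansion at every coarsening [J] of [I] writes [QFactA J] in terms of [e]; the inversion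
    formula then recovers [e I], which gives uniqueness. *)
Lemma L_expansion_ThmRHS (K : fieldType) n I (e : seq nat -> Fq K) :
  is_comp n.+1 I -> L_expansion n.+1 e -> e I = ThmRHS K n.+1 I.
Proof.
move=> HI He; rewrite /ThmRHS big_comps_finer //.
rewrite -(st_stp_inversion _ (qv K) (qv_neq0 K) n.+1 I e HI).
apply: eq_big_seq => J /(coarsenings_is_comp _ _ _ HI) HJ.
by rewrite -(sum_LJ K _ _ _ HJ) -He // SJ_ones.
Qed.

Lemma L_expansion_PTA (K : fieldType) n : L_expansion n.+1 (PTA K).
Proof.
move=> I HI; have I0 : I != [::] by apply: contraTneq HI => ->.
rewrite SJ_ones // sum_LJ //.
apply: etrans (esym (sum_tab_poly_horner1 _ (qv K) n.+1 I I0 HI)) _.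
apply: eq_big_seq => J /(coarsenings_is_comp _ _ _ HI)/andP[Jp _].
by rewrite PTA_tab_poly.
Qed.

Theorem mainTheorem1 (K : fieldType) (hK : [pchar K] =i pred0)
    (n : nat) (I : seq nat) :
  (0 < n)%N -> is_comp n I ->
  (exists e : seq nat -> Fq K, @L_expansion K n e) /\
  (forall e : seq nat -> Fq K, @L_expansion K n e -> e I = @PTA K I) /\
  @PTA K I = @ThmRHS K n I.
Proof.
(* Uniqueness applied to the solution [PTA] itself yields the equality of the tableau sum with the
   explicit formula. *)
case: n => // n _ HI; have PTA_RHS := L_expansion_ThmRHS K n I _ HI (L_expansion_PTA K n).
split; [by exists (PTA K); apply: L_expansion_PTA | split=> // e He].
by rewrite PTA_RHS; apply: L_expansion_ThmRHS.
Qed.
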